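(* Let $a_0<0$ and $a_1>0$ be real numbers, and let $f\in C^\infty[0,+\infty)$ be the unique solution of $$f''(\eta) = - f(\eta)\, f'(\eta)\, \eta \quad (\eta\ge 0), \qquad f(0)=a_0, \quad f'(0)=a_1.$$ Then the function $$u(x,y)= 2 f\left( \frac{y}{\sqrt{x}}\right), \qquad x>0,\ y\ge 0,$$ is a solution of the equation $u u_x - u_{yy} = 0$ on $\{(x,y): x>0,\ y\ge 0\}$, and $u$ changes sign on this set, i.e. it takes both negative and positive values there.
   Context: Functions are real-valued. $C^\infty[0,+\infty)$ denotes the functions on $[0,+\infty)$ that are infinitely differentiable, with one-sided derivatives at $0$. For every $a_0<0$ and $a_1>0$ the stated initial value problem has a unique solution in $C^\infty[0,+\infty)$, so $f$ is well defined. At points with $y=0$, derivatives of $u$ in $y$ are one-sided. *)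

(* Defs.v *)
From Stdlib Require Import Reals.
From Coquelicot Require Import Coquelicot.
Open Scope R_scope.

Definition half_line (t : R) : Prop := 0 <= t.

Definition half_plane (p : R * R) : Prop := 0 < fst p /\ 0 <= snd p.

(* [D_in g g' half_line t] is differentiability relative to [0,+oo): two-sided
   for t > 0, from the right at t = 0.  Values at negative arguments are
   irrelevant. *)
Definition has_deriv (g g' : R -> R) : Prop :=
  forall t, 0 <= t -> D_in g g' half_line t.

(* C^oo[0,+oo); [d n] is the n-th derivative on [0,+oo). *)
Definition smooth_half_line (f : R -> R) : Prop :=
  exists d : nat -> R -> R,
    (forall t, 0 <= t -> d O t = f t) /\
    (forall n, has_deriv (d n) (d (S n))).

Definition ivp_solution (a0 a1 : R) (f : R -> R) : Prop :=
  exists f' f'' : R -> R,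
    has_deriv f f' /\ has_deriv f' f'' /\
    (forall eta, 0 <= eta -> f'' eta = - f eta * f' eta * eta) /\
    f 0 = a0 /\ f' 0 = a1.

Definition continuous_half_plane (v : R -> R -> R) : Prop :=
  continuous_on half_plane (fun p : R * R => v (fst p) (snd p)).

(* Classical solution of u u_x - u_yy = 0 on {x > 0, y >= 0}: u and the
   derivatives u_x, u_y, u_yy exist and are jointly continuous there, the
   y-derivatives being one-sided at y = 0. *)
Definition pde_solution (u : R -> R -> R) : Prop :=
  exists ux uy uyy : R -> R -> R,
    continuous_half_plane u /\ continuous_half_plane ux /\
    continuous_half_plane uy /\ continuous_half_plane uyy /\
    forall x y, 0 < x -> 0 <= y ->
      is_derive (fun s => u s y) x (ux x y) /\
      D_in (u x) (uy x) half_line y /\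
      D_in (uy x) (uyy x) half_line y /\
      u x y * ux x y - uyy x y = 0.

Definition changes_sign (u : R -> R -> R) : Prop :=
  (exists x y, 0 < x /\ 0 <= y /\ u x y < 0) /\
  (exists x y, 0 < x /\ 0 <= y /\ 0 < u x y).

(* Main.v *)
Require Import Defs.
From Stdlib Require Import Reals Lra.
From Coquelicot Require Import Coquelicot.
Open Scope R_scope.

(** With [eta = y / sqrt x], the chain rule turns [u u_x = u_yy] into
    [f'' = - f f' eta].  For the sign change, [u x 0 = 2 a0 < 0]; if [f] were
    nonpositive on [0,+oo), then [(f'^2)' = - 2 f f'^2 eta >= 0], so
    [f'^2 >= a1^2], hence [f' >= a1] by connectedness, so
    [f t >= a0 + a1 t], which is positive for large [t]. *)

(** * One-sided calculus on [0,+oo) *)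

Lemma D_in_ext (f g f' g' : R -> R) (D : R -> Prop) (t : R) :
  (forall s, f s = g s) -> f' t = g' t -> D_in f f' D t -> D_in g g' D t.
Proof.
intros Hfg Hd Hf eps Heps.
destruct (Hf eps Heps) as [al [Hal H]].
exists al; split; [exact Hal |].
intros x Hx; rewrite <- !Hfg, <- Hd; exact (H x Hx).
Qed.

Lemma D_in_half_line_is_derive (g g' : R -> R) (t : R) :
  0 < t -> D_in g g' half_line t -> is_derive g t (g' t).
Proof.
intros Ht H.
apply is_derive_Reals; intros eps Heps.
destruct (H eps Heps) as [al [Hal Hl]].
(* A radius of at most [t] keeps [t + h] in the half-line, where the relative limit applies. *)
assert (Hd : 0 < Rmin al t) by (apply Rmin_pos; lra).
exists (mkposreal _ Hd); intros h Hh0 Hh; simpl in Hh.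
pose proof (Rmin_l al t); pose proof (Rmin_r al t).
destruct (Rabs_def2 _ _ Hh) as [Hh1 Hh2].
assert (Hin : D_x half_line t (t + h) /\ dist R_met (t + h) t < al).
{ split; [split; [unfold half_line; lra | lra] |].
  simpl; unfold Rdist; replace (t + h - t) with h by ring; lra. }
specialize (Hl _ Hin).
simpl in Hl; unfold Rdist in Hl.
replace (t + h - t) with h in Hl by ring; exact Hl.
Qed.

(* [fun s => g (Rmax 0 s)] extends [g] from [0,+oo) to a continuous function on
   the whole line, to which two-sided theorems apply. *)
Lemma has_deriv_continuous_Rmax (g g' : R -> R) (t : R) :
  has_deriv g g' -> continuous (fun s => g (Rmax 0 s)) t.
Proof.
intros H.
apply continuity_pt_filterlim; intros eps Heps.
pose proof (cont_deriv _ _ _ _ (H _ (Rmax_l 0 t))) as Hc.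
destruct (Hc eps Heps) as [al [Hal Hl]].
exists al; split; [exact Hal |].
intros s [_ Hs]; simpl in Hs |- *; unfold Rdist in Hs |- *.
(* The limit relative to the half-line excludes the base point itself, so equal clamped values are
   treated apart. Otherwise the same [al] works because [Rmax 0] is 1-Lipschitz. *)
destruct (Req_dec (Rmax 0 t) (Rmax 0 s)) as [E | E].
{ rewrite E, Rminus_diag, Rabs_R0; exact Heps. }
apply (Hl (Rmax 0 s)).
split; [split; [apply Rmax_l | exact E] |].
simpl; unfold Rdist; refine (Rle_lt_trans _ _ _ _ Hs).
unfold Rmax; repeat destruct Rle_dec; unfold Rabs; repeat destruct Rcase_abs; lra.
Qed.

Lemma D_in_half_line_scale (g g' : R -> R) (k c y : R) :
  0 < c -> 0 <= y -> has_deriv g g' ->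
  D_in (fun s => k * g (s * c)) (fun s => k * (c * g' (s * c))) half_line y.
Proof.
intros Hc Hy H.
apply Dmult_const.
assert (Hlin : D_in (fun s => s * c) (fun _ => c) half_line y).
{ intros eps Heps; exists 1; split; [lra |].
  intros s [[_ Hs] _]; simpl; unfold Rdist.
  replace ((s * c - y * c) / (s - y) - c) with 0 by (field; lra).
  rewrite Rabs_R0; exact Heps. }
assert (Hyc : 0 <= y * c) by nra.
pose proof (Dcomp _ _ _ _ _ _ _ Hlin (H _ Hyc)) as Hd.
(* [Dcomp] restricts to the points of the half-line whose image lies in it; as [0 < c], these are
   all of its points. *)
refine (limit1_imp _ _ _ _ _ _ Hd).
intros s [Hs Hne]; split; [| exact Hne].
split; unfold half_line in *; nra.
Qed.

Lemma has_deriv_MVT (g g' : R -> R) (t : R) :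
  has_deriv g g' -> 0 < t ->
  exists c, 0 <= c <= t /\ g t - g 0 = g' c * t.
Proof.
intros H Ht.
assert (Hex : exists c, Rmin 0 t <= c <= Rmax 0 t /\
  g (Rmax 0 t) - g (Rmax 0 0) = g' c * (t - 0)).
{ apply (MVT_gen (fun s => g (Rmax 0 s)) 0 t g').
  - rewrite Rmin_left, Rmax_right by lra; intros x [Hx _].
    apply (is_derive_ext_loc g).
    (* The ball of radius [x] around [x] stays positive, and there the extension coincides with
       [g]. *)
    + exists (mkposreal _ Hx); intros s Hs.
      apply Rabs_def2 in Hs; simpl in Hs; unfold minus, plus, opp in Hs; simpl in Hs.
      rewrite Rmax_right by lra; reflexivity.
    + apply D_in_half_line_is_derive; [exact Hx | apply H; lra].
  - intros x _; apply continuity_pt_filterlim.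
    exact (has_deriv_continuous_Rmax _ _ _ H). }
destruct Hex as [c [Hc E]].
rewrite Rmin_left, Rmax_right in Hc by lra.
rewrite Rmax_right, Rmax_left in E by lra.
exists c; split; [exact Hc | lra].
Qed.

(** * The sign change *)

Lemma ivp_solution_pos (a0 a1 : R) (f : R -> R) :
  0 < a1 -> ivp_solution a0 a1 f -> exists t, 0 <= t /\ 0 < f t.
Proof.
intros Ha1 (f' & f'' & Hf & Hf' & Hode & H0 & H1).
apply Classical_Prop.NNPP; intros Hno.
assert (Hneg : forall t, 0 <= t -> f t <= 0).
{ intros t Ht; apply Rnot_lt_le; intros Hpos; apply Hno; exists t; auto. }
assert (Hsq : forall t, 0 <= t -> a1 * a1 <= f' t * f' t).
{ intros t [Ht | <-]; [| rewrite H1; lra].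
  assert (Hd : has_deriv (fun s => f' s * f' s)
                         (fun s => f'' s * f' s + f' s * f'' s)).
  { intros s Hs; apply (Dmult half_line); apply Hf'; exact Hs. }
  destruct (has_deriv_MVT _ _ t Hd Ht) as [c [[Hc _] E]]; cbv beta in E.
  rewrite H1, Hode in E by exact Hc.
  assert (0 <= - f c * c * (f' c * f' c) * t).
  { pose proof (Hneg c Hc).
    apply Rmult_le_pos; [apply Rmult_le_pos; [nra | apply Rle_0_sqr] | lra]. }
  nra. }
assert (Hge : forall t, 0 <= t -> a1 <= f' t).
{ intros t Ht; pose proof (Hsq t Ht).
  destruct (Rle_lt_dec 0 (f' t)) as [Hp | Hn]; [nra | exfalso].
  (* A negative value of [f'] would force a zero between it and [f' 0 = a1], against [Hsq]. *)
  destruct (IVT_gen (fun s => f' (Rmax 0 s)) 0 t 0) as [z [_ Ez]].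
  - intros s; apply continuity_pt_filterlim.
    exact (has_deriv_continuous_Rmax _ _ _ Hf').
  - rewrite Rmax_left, Rmax_right, H1, Rmin_right, Rmax_left by lra; lra.
  - pose proof (Hsq _ (Rmax_l 0 z)); nra. }
pose proof (Hneg 0 (Rle_refl 0)) as Ha0; rewrite H0 in Ha0.
(* The line [a0 + a1 * t] vanishes at [- a0 / a1]; one unit further it equals [a1], so [f] is
   positive there. *)
assert (Ht : 0 < - a0 / a1 + 1).
{ assert (0 <= - a0 / a1) by (apply Rdiv_le_0_compat; lra); lra. }
destruct (has_deriv_MVT _ _ _ Hf Ht) as [c [[Hc _] E]].
pose proof (Hge c Hc); pose proof (Hneg _ (Rlt_le _ _ Ht)).
assert (a1 * (- a0 / a1 + 1) = - a0 + a1) by (field; lra).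
nra.
Qed.

Lemma ivp_solution_changes_sign (a0 a1 : R) (f : R -> R) :
  a0 < 0 -> 0 < a1 -> ivp_solution a0 a1 f ->
  changes_sign (fun x y => 2 * f (y / sqrt x)).
Proof.
intros Ha0 Ha1 Hf; split.
- exists 1, 0; rewrite sqrt_1, Rdiv_1_r.
  destruct Hf as (f' & f'' & _ & _ & _ & H0 & _); rewrite H0; lra.
- destruct (ivp_solution_pos _ _ _ Ha1 Hf) as [t [Ht Hp]].
  (* On the line [x = 1] the similarity variable is [y] itself. *)
  exists 1, t; rewrite sqrt_1, Rdiv_1_r; lra.
Qed.

(** * Joint continuity on the half-plane *)

Lemma continuous_similarity_variable (p : R * R) :
  half_plane p -> continuous (fun q : R * R => snd q / sqrt (fst q)) p.
Proof.
intros [Hx _].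
apply (continuous_mult (fun q : R * R => snd q) (fun q => / sqrt (fst q))).
- apply continuous_snd.
- apply (continuous_comp (fun q : R * R => sqrt (fst q)) Rinv).
  + apply (continuous_comp fst sqrt); [apply continuous_fst | apply continuous_sqrt].
  + apply continuous_Rinv, Rgt_not_eq, sqrt_lt_R0, Hx.
Qed.

Lemma similarity_variable_nonneg (x y : R) : 0 < x -> 0 <= y -> 0 <= y / sqrt x.
Proof.
intros Hx Hy; apply Rdiv_le_0_compat; [exact Hy | apply sqrt_lt_R0, Hx].
Qed.

(** Neighbourhoods of a boundary point contain points with [y < 0], where [g] is uncontrolled;
    clamping the argument changes nothing on the half-plane and gives full continuity. *)
Lemma continuous_half_plane_similarity (g g' : R -> R) :
  has_deriv g g' -> continuous_half_plane (fun x y => g (y / sqrt x)).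
Proof.
intros H.
apply (continuous_on_ext _ (fun q : R * R => g (Rmax 0 (snd q / sqrt (fst q))))).
- intros [x y] [Hx Hy]; simpl in *.
  now rewrite Rmax_right by (apply similarity_variable_nonneg; assumption).
- apply continuous_on_forall; intros p Hp.
  apply (continuous_comp (fun q : R * R => snd q / sqrt (fst q))
                         (fun s => g (Rmax 0 s))).
  + apply continuous_similarity_variable, Hp.
  + exact (has_deriv_continuous_Rmax _ _ _ H).
Qed.

Lemma continuous_half_plane_mult (v w : R -> R -> R) :
  continuous_half_plane v -> continuous_half_plane w ->
  continuous_half_plane (fun x y => v x y * w x y).
Proof.
intros Hv Hw p Hp.
eapply filterlim_comp_2; [exact (Hv p Hp) | exact (Hw p Hp) |].
apply (@filterlim_mult R_AbsRing).
Qed.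

Lemma continuous_half_plane_of_pos (g : R -> R) :
  (forall x, 0 < x -> continuous g x) ->
  continuous_half_plane (fun x _ => g x).
Proof.
intros H; apply continuous_on_forall; intros p [Hp _].
apply (continuous_comp fst g); [apply continuous_fst | apply H, Hp].
Qed.

(** * The derivatives of [u] and the equation *)

Lemma is_derive_similarity (f f' : R -> R) (x y : R) :
  has_deriv f f' -> 0 < x -> 0 <= y ->
  is_derive (fun s => 2 * f (y / sqrt s)) x
    (- / x * (y / sqrt x * f' (y / sqrt x))).
Proof.
(* For [y > 0] the chain rule applies, as [f] is differentiable on both sides at [y / sqrt x]. For
   [y = 0] the function of [s] is the constant [2 * f 0]. *)
intros Hf Hx [Hy | <-].
- assert (Hs := sqrt_lt_R0 x Hx).
  assert (Hpos : 0 < y / sqrt x) by (apply Rdiv_lt_0_compat; assumption).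
  assert (Hd := D_in_half_line_is_derive _ _ _ Hpos (Hf _ (Rlt_le _ _ Hpos))).
  assert (Hin : is_derive (fun s => y / sqrt s) x (- (y / (2 * (sqrt x * x))))).
  { auto_derive; [repeat split; lra |].
    (* [field] treats [sqrt x] as an atom, so the bare [x] is written as its square. *)
    replace x with (sqrt x * sqrt x) at 5 by (apply sqrt_sqrt; lra).
    field; lra. }
  pose proof (is_derive_scal _ _ 2 _ 
                (is_derive_comp f (fun s => y / sqrt s) _ _ _ Hd Hin)) as H.
  refine (eq_rect _ (is_derive _ x) H _ _).
  unfold scal; simpl; unfold mult; simpl; field; lra.
- apply (is_derive_ext (fun _ => 2 * f 0)).
  + intros s; unfold Rdiv; now rewrite Rmult_0_l.
  + unfold Rdiv; rewrite !Rmult_0_l, Rmult_0_r; apply (@is_derive_const R_AbsRing).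
Qed.

Lemma ivp_solution_pde (a0 a1 : R) (f : R -> R) :
  ivp_solution a0 a1 f -> pde_solution (fun x y => 2 * f (y / sqrt x)).
Proof.
intros (f' & f'' & Hf & Hf' & Hode & _ & _).
assert (Cconst : forall k, continuous_half_plane (fun _ _ => k)).
{ intros k; apply (continuous_half_plane_of_pos (fun _ => k)).
  intros; apply continuous_const. }
assert (Cinv : continuous_half_plane (fun x _ => / x)).
{ apply continuous_half_plane_of_pos; intros x Hx.
  apply continuous_Rinv; lra. }
assert (Csqrt : continuous_half_plane (fun x _ => / sqrt x)).
{ apply (continuous_half_plane_of_pos (fun x => / sqrt x)); intros x Hx.
  apply continuous_Rinv_comp;
    [apply continuous_sqrt | apply Rgt_not_eq, sqrt_lt_R0, Hx]. }
assert (Ceta : continuous_half_plane (fun x y => y / sqrt x)).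
{ apply continuous_on_forall; intros p Hp.
  exact (continuous_similarity_variable p Hp). }
pose proof (continuous_half_plane_similarity _ _ Hf) as Cf.
pose proof (continuous_half_plane_similarity _ _ Hf') as Cf'.
(* The form [-1 * / x] makes this a product of factors already known to be continuous. *)
assert (Cux : continuous_half_plane
  (fun x y => -1 * / x * (y / sqrt x * f' (y / sqrt x)))).
{ repeat (assumption || apply Cconst || apply continuous_half_plane_mult). }
(* The witness for [u_yy] is the product of [u] and [u_x]: it inherits their continuity and makes
   the equation an identity. The differential equation for [f] enters when this product is shown to
   be the derivative of [u_y]. *)
exists (fun x y => -1 * / x * (y / sqrt x * f' (y / sqrt x))),
       (fun x y => 2 * (/ sqrt x * f' (y / sqrt x))),
       (fun x y => 2 * f (y / sqrt x) *
                   (-1 * / x * (y / sqrt x * f' (y / sqrt x)))).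
split; [| split; [| split; [| split]]].
1-4: repeat (assumption || apply Cconst || apply continuous_half_plane_mult).
intros x y Hx Hy.
pose proof (Rinv_0_lt_compat _ (sqrt_lt_R0 x Hx)) as Hc.
split; [| split; [| split]].
- replace (-1 * / x) with (- / x) by ring.
  apply is_derive_similarity; assumption.
- exact (D_in_half_line_scale _ _ 2 _ _ Hc Hy Hf).
- refine (D_in_ext _ _ _ _ _ _ _ _
            (D_in_half_line_scale _ _ (2 * / sqrt x) _ _ Hc Hy Hf')).
  + intros s; unfold Rdiv; ring.
  + cbv beta; fold (y / sqrt x).
    rewrite Hode by (apply similarity_variable_nonneg; assumption).
    replace (/ x) with (/ sqrt x * / sqrt x)
      by (rewrite <- Rinv_mult, sqrt_sqrt by lra; reflexivity).
    ring.
- ring.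
Qed.

Theorem mainTheorem2 (a0 a1 : R) (f : R -> R)
    (ha0 : a0 < 0) (ha1 : 0 < a1)
    (hf : smooth_half_line f) (hivp : ivp_solution a0 a1 f) :
  let u := fun x y : R => 2 * f (y / sqrt x) in
  pde_solution u /\ changes_sign u.
Proof.
split.
- exact (ivp_solution_pde a0 a1 f hivp).
- exact (ivp_solution_changes_sign a0 a1 f ha0 ha1 hivp).
Qed.
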